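(* Let $s,x\in\mathbb{R}^6$ be such that $x\notin[s]$. Then $$S^{-1}_{\Delta\mathcal{D},L}(s,x):=\Delta\mathcal{D}\left(S_L^{-1}(s,x)\right)=16\,\mathcal{Q}_{c,s}(x)^{-2}$$ and $$S^{-1}_{\Delta\mathcal{D},R}(s,x):=\left(S_R^{-1}(s,x)\right)\mathcal{D}\Delta=16\,\mathcal{Q}_{c,s}(x)^{-2}.$$
   Context: $\mathbb{R}_5$ is the real Clifford algebra generated by $e_1,\dots,e_5$ with $e_i^2=-1$, $e_ie_j=-e_je_i$ for $i\ne j$. $\mathbb{R}^6$ is identified with paravectors $x=x_0+\underline{x}$, $\underline{x}=\sum_{i=1}^5x_ie_i$; $\overline{x}=x_0-\underline{x}$, $|x|^2=\sum_{i=0}^5x_i^2$. $\mathbb{S}=\{\underline{x}:|\underline{x}|=1\}$ and $[s]=\{s_0+J|\underline{s}|:J\in\mathbb{S}\}$. For $x\notin[s]$: $\mathcal{Q}_{c,s}(x)=s^2-2x_0s+|x|^2$, $S_L^{-1}(s,x)=(s-\overline{x})\mathcal{Q}_{c,s}(x)^{-1}$, $S_R^{-1}(s,x)=\mathcal{Q}_{c,s}(x)^{-1}(s-\overline{x})$. All operators act in the variable $x$: $\Delta=\sum_{i=0}^5\partial_{x_i}^2$; $\mathcal{D}f=\partial_{x_0}f+\sum_{i=1}^5e_i\partial_{x_i}f$ (left action), $f\mathcal{D}=\partial_{x_0}f+\sum_{i=1}^5(\partial_{x_i}f)e_i$ (right action). *)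

(* Defs.v *)
From HB Require Import structures.
From mathcomp Require Import all_boot all_order all_algebra.
From mathcomp Require Import all_classical all_reals all_analysis.
From mathcomp Require Import ring.

Set Implicit Arguments.
Unset Strict Implicit.
Unset Printing Implicit Defensive.

Import Order.TTheory GRing.Theory Num.Theory.
Import numFieldNormedType.Exports.

Local Open Scope classical_set_scope.
Local Open Scope ring_scope.

(** * The Clifford algebra with generators e_i, e_i ^ 2 = -1, e_i e_j = - e_j e_i

  An element is the family of its coordinates in the basis (e_A), where for
  A = {i_1 < ... < i_k} one sets e_A = e_(i_1) ... e_(i_k) (cf. [cblade_prod]).
  Then e_A e_B = (-1) ^ sigma(A, B) e_(A symdiff B), with sigma(A, B) the number
  of pairs (i, j) in A x B such that j <= i: a pair with j < i stands for a
  transposition of two distinct generators and i = j for a square e_i ^ 2. *)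

Definition symd (n : nat) (A B : {set 'I_n}) : {set 'I_n} :=
  [set i | (i \in A) (+) (i \in B)].

Lemma symdA n : associative (@symd n).
Proof. by move=> A B C; apply/setP => i; rewrite !inE addbA. Qed.

Lemma symdC n : commutative (@symd n).
Proof. by move=> A B; apply/setP => i; rewrite !inE addbC. Qed.

Lemma symd0 n (A : {set 'I_n}) : symd A finset.set0 = A.
Proof. by apply/setP => i; rewrite !inE addbF. Qed.

Lemma sym0d n (A : {set 'I_n}) : symd finset.set0 A = A.
Proof. by rewrite symdC symd0. Qed.

Lemma symdK n (A B : {set 'I_n}) : symd A (symd A B) = B.
Proof. by apply/setP => i; rewrite !inE addKb. Qed.

(* the parity of sigma(A, B) *)
Definition csign (n : nat) (A B : {set 'I_n}) : bool :=
  \big[addb/false]_(i < n) \big[addb/false]_(j < n)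
    [&& i \in A, j \in B & (j <= i)%N].

Lemma csign_symdl n (A B C : {set 'I_n}) :
  csign (symd A B) C = csign A C (+) csign B C.
Proof.
rewrite /csign -big_split; apply: eq_bigr => i _ /=.
rewrite -big_split; apply: eq_bigr => j _ /=; rewrite inE.
by case: (i \in A) (i \in B) => [] [] /=; rewrite ?addbb ?addbF.
Qed.

Lemma csign_symdr n (A B C : {set 'I_n}) :
  csign A (symd B C) = csign A B (+) csign A C.
Proof.
rewrite /csign -big_split; apply: eq_bigr => i _ /=.
rewrite -big_split; apply: eq_bigr => j _ /=; rewrite inE.
by case: (i \in A) (j \in B) (j \in C) => [] [] [] /=; rewrite ?addbb ?addbF.
Qed.

Lemma csign0l n (A : {set 'I_n}) : csign finset.set0 A = false.
Proof. by rewrite /csign big1// => i _; rewrite big1// => j _; rewrite inE. Qed.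

Lemma csign0r n (A : {set 'I_n}) : csign A finset.set0 = false.
Proof.
by rewrite /csign big1// => i _; rewrite big1// => j _; rewrite inE andbF.
Qed.

(* [{ffun _ -> _}] carries the pointwise product, hence the new type *)
Definition clifford (R : comNzRingType) (n : nat) : Type := {ffun {set 'I_n} -> R}.

HB.instance Definition _ (R : comNzRingType) (n : nat) :=
  GRing.Lmodule.copy (clifford R n) {ffun {set 'I_n} -> R^o}.

Definition ccoord (R : comNzRingType) (n : nat) (x : clifford R n)
  (A : {set 'I_n}) : R := (x : {ffun {set 'I_n} -> R}) A.

Definition cblade (R : comNzRingType) (n : nat) (A : {set 'I_n}) :
  clifford R n := [ffun B => (B == A)%:R].

(* e_A e_B contributes to the coordinate on e_C exactly when B = A symdiff C *)
Definition cmul (R : comNzRingType) (n : nat) (x y : clifford R n) :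
  clifford R n :=
  [ffun C => \sum_(A : {set 'I_n})
     (-1) ^+ csign A (symd A C) * (ccoord x A * ccoord y (symd A C))].

Section CliffordRing.
Context (R : comNzRingType) (n : nat).
Implicit Types (x y z : clifford R n) (A B C : {set 'I_n}).

Lemma cliffordP x y : (forall A, ccoord x A = ccoord y A) -> x = y.
Proof. by move=> xy; apply/ffunP => A; exact: xy. Qed.

Lemma ccoordD x y A : ccoord (x + y) A = ccoord x A + ccoord y A.
Proof. by rewrite /ccoord ffunE. Qed.

Lemma ccoordZ (a : R) x A : ccoord (a *: x) A = a * ccoord x A.
Proof. by rewrite /ccoord ffunE. Qed.

Lemma ccoord_blade A B : ccoord (cblade R A) B = (B == A)%:R.
Proof. by rewrite /ccoord ffunE. Qed.

Lemma ccoord_cmul x y C : ccoord (cmul x y) C = \sum_(A : {set 'I_n})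
  (-1) ^+ csign A (symd A C) * (ccoord x A * ccoord y (symd A C)).
Proof. by rewrite {1}/ccoord ffunE. Qed.

Lemma cmulA : associative (@cmul R n).
Proof.
move=> x y z; apply: cliffordP => D; rewrite !ccoord_cmul.
under eq_bigr do rewrite ccoord_cmul mulrA big_distrr /=.
under [RHS]eq_bigr do rewrite ccoord_cmul big_distrl big_distrr /=.
rewrite [RHS]exchange_big; apply: eq_bigr => A _ /=.
rewrite [RHS](reindex_inj (can_inj (@symdK _ A))); apply: eq_bigr => B _ /=.
rewrite !symdK -!symdA.
have -> : symd A (symd B D) = symd B (symd A D).
  by rewrite symdA (symdC A) -symdA.
move: (ccoord x A) (ccoord y B) (ccoord z _) => a b c.
rewrite csign_symdl !csign_symdr !signr_addb.
by case: (csign A B); rewrite /= ?expr0 ?expr1; ring.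
Qed.

Lemma cmul1l : left_id (cblade R finset.set0) (@cmul R n).
Proof.
move=> x; apply: cliffordP => C; rewrite ccoord_cmul (bigD1 finset.set0) //=.
rewrite big1 => [|A A0]; last by rewrite ccoord_blade (negbTE A0) mul0r mulr0.
by rewrite ccoord_blade eqxx csign0l expr0 sym0d !mul1r addr0.
Qed.

Lemma cmul1r : right_id (cblade R finset.set0) (@cmul R n).
Proof.
move=> x; apply: cliffordP => C; rewrite ccoord_cmul (bigD1 C) //=.
have CC A : symd A A = finset.set0 by apply/setP => i; rewrite !inE addbb.
rewrite big1 => [|A AC].
  by rewrite CC ccoord_blade eqxx csign0r expr0 mulr1 mul1r addr0.
rewrite ccoord_blade; case: eqP => [AC0|_]; last by rewrite !mulr0.
by move/eqP: AC; rewrite -{1}(symd0 A) -AC0 symdK.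
Qed.

Lemma cmulDl : left_distributive (@cmul R n) +%R.
Proof.
move=> x y z; apply: cliffordP => C; rewrite ccoordD !ccoord_cmul -big_split.
by apply: eq_bigr => A _ /=; rewrite ccoordD mulrDl mulrDr.
Qed.

Lemma cmulDr : right_distributive (@cmul R n) +%R.
Proof.
move=> x y z; apply: cliffordP => C; rewrite ccoordD !ccoord_cmul -big_split.
by apply: eq_bigr => A _ /=; rewrite ccoordD !mulrDr.
Qed.

Lemma cblade0_neq0 : cblade R finset.set0 != 0 :> clifford R n.
Proof.
apply/eqP => /(congr1 (fun x => ccoord x finset.set0)).
by rewrite ccoord_blade eqxx /ccoord ffunE => /eqP; rewrite oner_eq0.
Qed.

HB.instance Definition _ := GRing.Zmodule_isNzRing.Build (clifford R n)
  cmulA cmul1l cmul1r cmulDl cmulDr cblade0_neq0.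

Lemma ccoordM x y C : ccoord (x * y) C = \sum_(A : {set 'I_n})
  (-1) ^+ csign A (symd A C) * (ccoord x A * ccoord y (symd A C)).
Proof. exact: ccoord_cmul. Qed.

Lemma cscaleAl (a : R) x y : a *: (x * y) = a *: x * y.
Proof.
apply: cliffordP => C; rewrite ccoordZ !ccoordM big_distrr.
by apply: eq_bigr => A _; rewrite /= ccoordZ mulrCA !mulrA.
Qed.

HB.instance Definition _ := GRing.Lmodule_isLalgebra.Build R (clifford R n)
  cscaleAl.

Lemma cscaleAr (a : R) x y : a *: (x * y) = x * (a *: y).
Proof.
apply: cliffordP => C; rewrite ccoordZ !ccoordM big_distrr.
apply: eq_bigr => A _; rewrite /= ccoordZ mulrCA; congr (_ * _).
by rewrite mulrCA.
Qed.

HB.instance Definition _ := GRing.Lalgebra_isAlgebra.Build R (clifford R n)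
  cscaleAr.

(* x ^-1 is the two-sided inverse of x in the algebra when there is one *)
Definition cunit : pred (clifford R n) :=
  fun x => `[< exists y, y * x = 1 /\ x * y = 1 >].

Definition cinv x : clifford R n :=
  xget x [set y | y * x = 1 /\ x * y = 1].

Lemma cinvP x : cunit x -> cinv x * x = 1 /\ x * cinv x = 1.
Proof. by move=> /asboolP; exact: xgetPex. Qed.

Fact cmulVr : {in cunit, left_inverse 1 cinv *%R}.
Proof. by move=> x /cinvP[]. Qed.

Fact cmulrV : {in cunit, right_inverse 1 cinv *%R}.
Proof. by move=> x /cinvP[]. Qed.

Fact cunitP x y : y * x = 1 /\ x * y = 1 -> cunit x.
Proof. by move=> yx; apply/asboolP; exists y. Qed.

Fact cinv_out : {in [predC cunit], cinv =1 id}.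
Proof.
move=> x /negP xU; apply: xgetPN => y yx; apply: xU.
exact: (cunitP yx).
Qed.

HB.instance Definition _ := GRing.NzRing_hasMulInverse.Build (clifford R n)
  cmulVr cmulrV cunitP cinv_out.

End CliffordRing.

Definition cgen (R : comNzRingType) (n : nat) (i : 'I_n) : clifford R n :=
  cblade R [set i]%SET.

Section CliffordRelations.
Context (R : comNzRingType) (n : nat).
Implicit Types (A B : {set 'I_n}) (i j : 'I_n).

Lemma cbladeM A B :
  cblade R A * cblade R B = (-1) ^+ csign A B *: cblade R (symd A B).
Proof.
apply: cliffordP => C; rewrite ccoordM ccoordZ (bigD1 A) //= big1; last first.
  by move=> A' /negbTE A'A; rewrite ccoord_blade A'A mul0r mulr0.
rewrite !ccoord_blade eqxx mul1r addr0.
have -> : (symd A C == B) = (C == symd A B).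
  by apply/eqP/eqP => [<-|->]; rewrite symdK.
by case: eqP => [->|_]; rewrite ?symdK// !mulr0.
Qed.

Lemma csign1 i j : csign [set i]%SET [set j]%SET = (j <= i)%N.
Proof.
rewrite /csign (bigD1 i) //= [X in _ (+) X]big1 ?addbF => [|k ki]; last first.
  by rewrite big1// => l _; rewrite inE (negbTE ki).
rewrite (bigD1 j) //= [X in _ (+) X]big1 ?addbF => [|k kj]; last first.
  by rewrite !inE (negbTE kj) andbF.
by rewrite !inE !eqxx.
Qed.

Lemma cgen_sqr i : cgen R i ^+ 2 = -1.
Proof.
rewrite expr2 cbladeM csign1 leqnn expr1 scaleN1r; congr (- cblade R _).
by apply/setP => k; rewrite !inE addbb.
Qed.

Lemma cgen_anticomm i j : i != j -> cgen R i * cgen R j = - (cgen R j * cgen R i).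
Proof.
move=> ij; rewrite !cbladeM !csign1 symdC -scaleNr; congr (_ *: _).
by case: (ltngtP i j) ij => [||/val_inj->]; rewrite ?eqxx// expr0 expr1 ?opprK.
Qed.

Lemma cblade_prod A : cblade R A = \prod_(i <- enum A) cgen R i.
Proof.
have sorted_prod (s : seq 'I_n) : sorted (fun i j : 'I_n => (i < j)%N) s ->
    \prod_(i <- s) cgen R i = cblade R [set i in s]%SET.
  have ltT : transitive (fun i j : 'I_n => (i < j)%N).
    by move=> i j k; exact: ltn_trans.
  elim: s => [|i s IHs] /=.
    by rewrite big_nil => _; congr (cblade R _); apply/setP => i; rewrite !inE.
  rewrite big_cons => si; rewrite IHs ?(path_sorted si)// cbladeM.
  move: si; rewrite path_sortedE// => /andP[/allP si _].
  have -> : csign [set i]%SET [set j in s]%SET = false.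
    rewrite /csign big1// => k _; rewrite big1// => j _; rewrite !inE.
    by case: eqP => //= ->; case: (boolP (j \in s)) => //= /si; rewrite ltnNge =>
      /negbTE.
  rewrite expr0 scale1r; congr (cblade R _); apply/setP => k; rewrite !inE.
  by case: eqP => //= ->; case: (boolP (i \in s)) => //= /si; rewrite ltnn.
rewrite sorted_prod; first by congr (cblade R _); apply/setP => i;
  rewrite inE mem_enum.
rewrite /enum_mem; apply: sorted_filter; first by move=> i j k; exact: ltn_trans.
rewrite -(enumT (ordinal n)).
by have := iota_ltn_sorted 0 n; rewrite -val_enum_ord sorted_map.
Qed.

End CliffordRelations.

(** * Paravectors

  The point (x_0, ..., x_n) of R^(n+1) is a row vector. The norm [`|x|] of the
  library on row vectors is the sup norm, hence [enorm] below. *)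

Section Paravector.
Context (R : realType) (n : nat).
Implicit Types x s : 'rV[R]_n.+1.

Definition pscal (a : R) : 'rV[R]_n.+1 := a *: delta_mx 0 ord0.

Definition pvec x : 'rV[R]_n.+1 := x - pscal (x 0 ord0).

Definition pconj x : 'rV[R]_n.+1 := pscal (x 0 ord0) - pvec x.

Definition enorm2 x : R := \sum_(i < n.+1) x 0 i ^+ 2.

Definition enorm x : R := Num.sqrt (enorm2 x).

(* the set S of unit vectors with zero real part *)
Definition usphere : set 'rV[R]_n.+1 :=
  [set J : 'rV[R]_n.+1 | J 0 ord0 = 0 /\ enorm J = 1].

(* the set [s] *)
Definition psphere s : set 'rV[R]_n.+1 :=
  [set pscal (s 0 ord0) + enorm (pvec s) *: J | J in usphere].

(* x_0 + x_1 e_1 + ... + x_n e_n; the generator e_(i+1) is [cgen R i] *)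
Definition pclif x : clifford R n :=
  (x 0 ord0)%:A + \sum_(i < n) x 0 (lift ord0 i) *: cgen R i.

Definition Qc s x : clifford R n :=
  pclif s ^+ 2 - (2 * x 0 ord0) *: pclif s + (enorm2 x)%:A.

Definition SLinv s x : clifford R n := (pclif s - pclif (pconj x)) * (Qc s x)^-1.

Definition SRinv s x : clifford R n := (Qc s x)^-1 * (pclif s - pclif (pconj x)).

Implicit Type f : 'rV[R]_n.+1 -> clifford R n.

Definition pderivable (i : 'I_n.+1) f x : Prop :=
  forall A : {set 'I_n}, derivable (fun y => ccoord (f y) A) x (delta_mx 0 i).

Definition pderiv (i : 'I_n.+1) f x : clifford R n :=
  [ffun A => ('D_(delta_mx 0 i) (fun y => ccoord (f y) A) x : R)].

Definition Dleft f x : clifford R n :=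
  pderiv ord0 f x + \sum_(i < n) cgen R i * pderiv (lift ord0 i) f x.

Definition Dright f x : clifford R n :=
  pderiv ord0 f x + \sum_(i < n) pderiv (lift ord0 i) f x * cgen R i.

Definition laplacian f x : clifford R n :=
  \sum_(i < n.+1) pderiv i (pderiv i f) x.

(* [pderiv] is total: these state that the derivatives occurring in
   [Dleft f], [Dright f] near x, respectively in [laplacian f x], exist *)
Definition pdiff1 f x : Prop :=
  \forall y \near x, forall i, pderivable i f y.

Definition pdiff2 f x : Prop :=
  pdiff1 f x /\ forall i, pderivable i (pderiv i f) x.

Definition SDeltaDL s x : clifford R n := laplacian (Dleft (SLinv s)) x.

Definition SDeltaDR s x : clifford R n := laplacian (Dright (SRinv s)) x.

End Paravector.

(* Main.v *)
Require Import Defs.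
From HB Require Import structures.
From mathcomp Require Import all_boot all_order all_algebra.
From mathcomp Require Import all_classical all_reals all_analysis.
From mathcomp Require Import ring.

Set Implicit Arguments.
Unset Strict Implicit.
Unset Printing Implicit Defensive.

Import Order.TTheory GRing.Theory Num.Theory.
Import numFieldNormedType.Exports.

Local Open Scope ring_scope.

(** Write Q for [Qc s x], e_0 = 1, ..., e_n for the standard basis of paravectors,
  and q_i = 2 x_i - 2 [i = 0] s for the i-th partial derivative of Q
  ([is_pderiv_Qc]). Everything happens in dimension n + 1 and reduces to the
  inverse of Q, for two reasons.

  First, Q and the q_i are polynomials in s with real coefficients, so they
  commute with each other and with Q^-1, and d_i (Q^-1) = - q_i Q^-2. The product
  rule turns the left Dirac operator applied to (s - conj x) Q^-1 into
    - (sum_i e_i conj(e_i)) Q^-1 - (sum_i e_i (s - conj x) q_i) Q^-2.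
  The first sum is n + 1; the relations x conj x = |x|^2 and x + conj x = 2 x_0
  show that the second one is - 2 Q ([sum_Qder_left]). Hence the result is
  (1 - n) Q^-1 ([Dleft_SLinv]), and likewise on the right ([Dright_SRinv]).

  Second, d_i^2 (Q^-1) = 2 q_i^2 Q^-3 - 2 Q^-2, and sum_i q_i^2 = 4 Q
  ([sum_Qder_sqr]), so the Laplacian of Q^-1 is (8 - 2 (n + 1)) Q^-2
  ([laplacian_QcV]). For n = 5 the product of the constants is
  (1 - 5) (6 - 10) = 16.

  The analytic input is that Q is invertible with differentiable inverse near
  every x outside the sphere of s. Splitting s into its scalar part and its
  vector part v, one has Q = a + b v with a, b polynomials in x and v^2 = - |v|^2,
  so Q^-1 = (a - b v) / N with N = a^2 + b^2 |v|^2 ([QcV]). The real polynomial N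
  vanishes only on the sphere of s ([Qnorm2_neq0]), hence by
  continuity nowhere near a point x outside it. *)

(** * Paravectors in the Clifford algebra *)

Lemma ccoordN (R : comNzRingType) (n : nat) (a : clifford R n) A :
  ccoord (- a) A = - ccoord a A.
Proof. by rewrite /ccoord ffunE. Qed.

(** Coordinatewise, linear identities between Clifford numbers become ring
  identities in R. *)
Ltac by_coord :=
  apply: cliffordP => ?; rewrite !(ccoordD, ccoordN, ccoordZ); ring.

Section ParavectorAlgebra.
Context {R : realType} {n : nat}.
Implicit Types (x y s : 'rV[R]_n.+1) (i j : 'I_n).

Lemma pclif_is_linear : linear (@pclif R n).
Proof.
move=> a x y; rewrite /pclif !mxE scalerDr scalerDl scalerA addrACA.
congr (_ + _); rewrite scaler_sumr -big_split; apply: eq_bigr => i _ /=.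
by rewrite !mxE scalerDl scalerA.
Qed.
HB.instance Definition _ := GRing.isLinear.Build R 'rV[R]_n.+1 (clifford R n)
  *:%R (@pclif R n) pclif_is_linear.

Lemma pscal_is_linear : linear (@pscal R n).
Proof. by move=> a b c; rewrite /pscal scalerDl -scalerA. Qed.
HB.instance Definition _ := GRing.isLinear.Build R R^o 'rV[R]_n.+1
  *:%R (@pscal R n) pscal_is_linear.

Lemma pscal0i (a : R) (i : 'I_n.+1) : pscal n a 0 i = a * (i == ord0)%:R.
Proof. by rewrite !mxE eqxx. Qed.

Lemma pvec0 x : pvec x 0 ord0 = 0.
Proof. by rewrite !mxE !eqxx mulr1 subrr. Qed.

Lemma pvecS x i : pvec x 0 (lift ord0 i) = x 0 (lift ord0 i).
Proof. by rewrite !mxE mulr0 subr0. Qed.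

Lemma pclif_pscal (a : R) : pclif (pscal n a) = a%:A.
Proof.
rewrite /pclif pscal0i eqxx mulr1 big1 ?addr0// => i _.
by rewrite pscal0i mulr0 scale0r.
Qed.

Lemma pclif_pvec x : pclif x = (x 0 ord0)%:A + pclif (pvec x).
Proof. by rewrite /pvec linearB /= pclif_pscal addrC subrK. Qed.

Lemma pconjE x : pconj x = pscal n (2 * x 0 ord0) - x.
Proof.
by rewrite /pconj /pvec opprB addrA -linearD /=; congr (pscal _ _ - _); ring.
Qed.

Lemma pclif_conj x : pclif (pconj x) = (2 * x 0 ord0)%:A - pclif x.
Proof. by rewrite pconjE linearB /= pclif_pscal. Qed.

Lemma cgen_sym i j :
  cgen R i * cgen R j + cgen R j * cgen R i = (- 2 * (i == j)%:R)%:A.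
Proof.
have [->|ij] := eqVneq i j; last by rewrite cgen_anticomm// addNr mulr0 scale0r.
by rewrite -expr2 cgen_sqr mulr1 scaleNr scaler_nat mulr2n opprD.
Qed.

Lemma enorm2_ge0 x : 0 <= enorm2 x.
Proof. by apply: sumr_ge0 => i _; rewrite sqr_ge0. Qed.

Lemma enorm2_eq0 x : enorm2 x = 0 -> x = 0.
Proof.
move/eqP; rewrite /enorm2 psumr_eq0 => [/allP x0|i _]; last exact: sqr_ge0.
apply/rowP => i; rewrite mxE; apply/eqP; rewrite -sqrf_eq0.
exact: (x0 i (mem_index_enum _)).
Qed.

Lemma enorm2Z (a : R) x : enorm2 (a *: x) = a ^+ 2 * enorm2 x.
Proof.
by rewrite /enorm2 mulr_sumr; apply: eq_bigr => i _; rewrite mxE exprMn.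
Qed.

Lemma enorm2_pvec x : enorm2 x = x 0 ord0 ^+ 2 + enorm2 (pvec x).
Proof.
rewrite /enorm2 !big_ord_recl pvec0 expr0n add0r; congr (_ + _).
by apply: eq_bigr => i _; rewrite pvecS.
Qed.

(** The square is a double sum over i, j; adding its transpose makes the mixed
  terms cancel by anticommutation. *)
Lemma pvec_sqr x : pclif (pvec x) ^+ 2 = - (enorm2 (pvec x))%:A.
Proof.
rewrite {1}/pclif pvec0 scale0r add0r /enorm2 big_ord_recl pvec0 expr0n add0r.
set v := \sum_i _; set w := \sum_i _.
have vv : v * v = \sum_i \sum_j
    (pvec x 0 (lift ord0 i) * pvec x 0 (lift ord0 j)) *: (cgen R i * cgen R j).
  rewrite /v big_distrl; apply: eq_bigr => i _ /=.
  rewrite big_distrr; apply: eq_bigr => j _ /=.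
  by rewrite -scalerAl -scalerAr scalerA.
have two_neq0 : (2 : R) != 0 by rewrite pnatr_eq0.
apply: (scalerI two_neq0); rewrite expr2 scaler_nat mulr2n {1}vv exchange_big.
rewrite vv -big_split /=.
have -> : 2 *: - w%:A = (- 2 * w)%:A :> clifford R n.
  by rewrite scalerN scalerA mulNr scaleNr.
rewrite /w mulr_sumr scaler_suml; apply: eq_bigr => i _; rewrite -big_split /=.
rewrite (bigD1 i) //= [X in _ + X]big1 => [|j ji].
  by rewrite addr0 -scalerDr cgen_sym eqxx mulr1 scalerA; congr (_ *: _); ring.
rewrite mulrC -scalerDr cgen_sym (negbTE ji) mulr0.
by rewrite scale0r scaler0.
Qed.

Lemma pclif_sqr x :
  pclif x ^+ 2 = (2 * x 0 ord0) *: pclif x - (enorm2 x)%:A.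
Proof.
(* [pclif] unfolds to a sum, which distributivity must not reach *)
rewrite enorm2_pvec pclif_pvec; have := pvec_sqr x.
move: (x 0 ord0) (pclif _) => a v vv.
rewrite expr2 mulrDl !mulrDr -!scalerAl !mul1r -!scalerAr mulr1.
by rewrite -expr2 vv; by_coord.
Qed.

Lemma pclifM_conj x : pclif x * pclif (pconj x) = (enorm2 x)%:A.
Proof.
by rewrite pclif_conj mulrBr -scalerAr mulr1 -expr2 pclif_sqr opprB addrC subrK.
Qed.

Lemma pclif_conjM x : pclif (pconj x) * pclif x = (enorm2 x)%:A.
Proof.
by rewrite pclif_conj mulrBl -scalerAl mul1r -expr2 pclif_sqr opprB addrC subrK.
Qed.

Lemma pclif_sum x : \sum_i x 0 i *: pclif (delta_mx 0 i) = pclif x.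
Proof.
rewrite {2}(row_sum_delta x) linear_sum.
by apply: eq_bigr => i _; rewrite linearZ.
Qed.

Lemma cgen_pclif j :
  pclif (delta_mx 0 (lift ord0 j) : 'rV[R]_n.+1) = cgen R j.
Proof.
rewrite /pclif mxE eqxx /= scale0r add0r (bigD1 j) //= big1 ?addr0 => [|k kj].
  by rewrite mxE !eqxx scale1r.
by rewrite mxE eqxx (inj_eq lift_inj) (negbTE kj) scale0r.
Qed.

Lemma pclif_delta0 : pclif (delta_mx 0 ord0 : 'rV[R]_n.+1) = 1.
Proof.
by rewrite -[delta_mx _ _]scale1r -/(pscal n 1) pclif_pscal scale1r.
Qed.

Lemma enorm2_delta (i : 'I_n.+1) : enorm2 (delta_mx 0 i : 'rV[R]_n.+1) = 1.
Proof.
rewrite /enorm2 (bigD1 i) //= big1 ?addr0 => [|j ji].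
  by rewrite mxE !eqxx expr1n.
by rewrite mxE eqxx (negbTE ji) expr0n.
Qed.

Definition Qre s y : R :=
  (y 0 ord0 - s 0 ord0) ^+ 2 + enorm2 (pvec y) - enorm2 (pvec s).

Definition Qim s y : R := 2 * (s 0 ord0 - y 0 ord0).

(** The coefficients are real and [pclif (pvec s)] squares to a nonpositive real,
  so the values of [Qc s] lie in a copy of the complex plane, which depends on s
  only. *)
Lemma QcE s y : Qc s y = (Qre s y)%:A + Qim s y *: pclif (pvec s).
Proof.
rewrite /Qc pclif_sqr (enorm2_pvec s) (enorm2_pvec y) (pclif_pvec s) /Qre /Qim.
by_coord.
Qed.

Definition Qconj s y : clifford R n :=
  (Qre s y)%:A - Qim s y *: pclif (pvec s).

(** The square of the modulus in that plane. *)
Definition Qnorm2 s y : R := Qre s y ^+ 2 + Qim s y ^+ 2 * enorm2 (pvec s).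

Lemma cplx_mul (a b c d r : R) (v : clifford R n) : v ^+ 2 = - r%:A ->
  (a%:A + b *: v) * (c%:A + d *: v) =
  (a * c - b * d * r)%:A + (a * d + b * c) *: v.
Proof.
move=> vv; set rhs := RHS.
rewrite mulrDl !mulrDr -!scalerAl !mul1r -!scalerAr mulr1 -expr2 vv /rhs.
by_coord.
Qed.

Lemma QcM_conj s y :
  Qc s y * Qconj s y = (Qnorm2 s y)%:A /\ Qconj s y * Qc s y = (Qnorm2 s y)%:A.
Proof.
rewrite QcE /Qconj -scaleNr !(cplx_mul _ _ _ _ (pvec_sqr s)).
by rewrite /Qnorm2; split; by_coord.
Qed.

(** Both summands vanish. If the second one does so because s is real, then
  the real part is already the sum of squares |y - s|^2. *)
Lemma Qnorm2_eq0 s y : Qnorm2 s y = 0 ->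
  y 0 ord0 = s 0 ord0 /\ enorm2 (pvec y) = enorm2 (pvec s).
Proof.
rewrite /Qnorm2 /Qre /Qim.
have := enorm2_ge0 (pvec y); have := enorm2_ge0 (pvec s).
move: (enorm2 (pvec y)) (enorm2 (pvec s)) (y 0 _) (s 0 _) => p q a b q0 p0.
move/eqP; rewrite paddr_eq0 ?sqr_ge0 ?(mulr_ge0 (sqr_ge0 _) q0)//.
rewrite sqrf_eq0 mulf_eq0 sqrf_eq0 mulf_eq0 pnatr_eq0 /= !subr_eq0 => /andP[].
move=> /eqP pq /orP[/eqP ba|/eqP q_eq0].
  by split=> //; rewrite -pq ba subrr expr0n add0r.
move: pq; rewrite q_eq0 => /eqP; rewrite paddr_eq0 ?sqr_ge0//.
by rewrite sqrf_eq0 subr_eq0 => /andP[/eqP-> /eqP->].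
Qed.

End ParavectorAlgebra.

(** If s has a vector part, the point of the unit sphere is the direction of
  [pvec y]; otherwise the sphere of s is the point s, and a unit vector is needed
  to exhibit it, whence the dimension at least 2. *)
Lemma Qnorm2_neq0 {R : realType} {n : nat} (s y : 'rV[R]_n.+2) :
  ~ psphere s y -> Qnorm2 s y != 0.
Proof.
move=> sy; apply/eqP => /Qnorm2_eq0[y0 yv]; apply: sy.
have [sv0|sv0] := eqVneq (enorm2 (pvec s)) 0.
  exists (delta_mx 0 (lift ord0 ord0)) => /=.
    by split; rewrite ?mxE ?andbF// /enorm enorm2_delta sqrtr1.
  rewrite /enorm sv0 sqrtr0 scale0r addr0.
  by have /subr0_eq-> := enorm2_eq0 (etrans yv sv0); rewrite y0.
have svn0 : enorm (pvec s) != 0 by rewrite sqrtr_eq0 -ltNge lt0r sv0 enorm2_ge0.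
exists ((enorm (pvec s))^-1 *: pvec y) => /=.
  split; first by rewrite mxE pvec0 mulr0.
  rewrite /enorm enorm2Z yv exprVn sqr_sqrtr ?enorm2_ge0//.
  by rewrite mulVf// sqrtr1.
by rewrite scalerA divff// scale1r -y0 /pvec addrC subrK.
Qed.

(** * Partial derivatives of Clifford-valued functions *)

Section RealDerivatives.
Context {R : realType} {V : normedModType R}.
Implicit Types (x v : V) (f : V -> R).

Lemma is_derive_affine f x v (c : R) :
  (forall h : R, f (h *: v + x) = f x + h * c) -> is_derive x v f c.
Proof.
move=> fE.
have cvgc :
    ((fun h => h^-1 *: ((f \o shift x) (h *: v) - f x)) @ 0^' --> c)%classic.
  apply: cvg_near_cst; near=> h.
  have h0 : h != 0 by near: h; exact: nbhs_dnbhs_neq.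
  by rewrite /= fE addrC addKr /GRing.scale /= mulKf.
by apply: DeriveDef; [apply/cvg_ex; exists c|apply/cvg_lim].
Unshelve. all: by end_near. Qed.

Lemma is_derive_bigsum (I : Type) (r : seq I) (h : I -> V -> R) (dh : I -> R)
    x v :
  (forall i, is_derive x v (h i) (dh i)) ->
  is_derive x v (fun y => \sum_(i <- r) h i y) (\sum_(i <- r) dh i).
Proof.
move=> dhP; elim: r => [|i r IHr].
  rewrite big_nil (_ : (fun y => _) = cst 0); last first.
    by apply/funext => y; rewrite big_nil.
  exact: is_derive_cst.
rewrite big_cons (_ : (fun y => _) = h i + (fun y => \sum_(j <- r) h j y)).
  exact: is_deriveD.
by apply/funext => y; rewrite big_cons.
Qed.

End RealDerivatives.

Section PartialDerivatives.
Context {R : realType} {n : nat}.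
Implicit Types (x y : 'rV[R]_n.+1) (i : 'I_n.+1).
Implicit Types (f g : 'rV[R]_n.+1 -> clifford R n) (u v : clifford R n).
Implicit Types (r : 'rV[R]_n.+1 -> R).

Definition is_pderiv i f x v : Prop := forall A,
  is_derive x (delta_mx 0 i : 'rV[R]_n.+1)
    (fun y => ccoord (f y) A) (ccoord v A).

Lemma is_pderiv_derivable {i f x v} : is_pderiv i f x v -> pderivable i f x.
Proof. by move=> df A; case: (df A). Qed.

Lemma is_pderivE {i f x v} : is_pderiv i f x v -> pderiv i f x = v.
Proof.
move=> df; apply: cliffordP => A; rewrite /ccoord /pderiv ffunE.
by case: (df A).
Qed.

Lemma pderivableP {i f x} : pderivable i f x -> is_pderiv i f x (pderiv i f x).
Proof. by move=> df A; rewrite {2}/ccoord /pderiv ffunE; exact/derivableP. Qed.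

Lemma is_pderiv_near i f g x v : (\near x, f x = g x) ->
  is_pderiv i f x v -> is_pderiv i g x v.
Proof.
move=> fg df A; apply: near_eq_is_derive (df A).
by apply: filterS fg => y ->.
Qed.

Lemma is_pderiv_cst i x v : is_pderiv i (fun=> v) x 0.
Proof.
move=> A; rewrite (_ : ccoord 0 A = 0); last by rewrite /ccoord ffunE.
exact: is_derive_cst.
Qed.

Lemma is_pderivD i f g x u v : is_pderiv i f x u -> is_pderiv i g x v ->
  is_pderiv i (fun y => f y + g y) x (u + v).
Proof.
move=> df dg A; rewrite ccoordD.
rewrite (_ : (fun y => _) =
    (fun y => ccoord (f y) A) + (fun y => ccoord (g y) A)).
  exact: is_deriveD.
by apply/funext => y; rewrite ccoordD.
Qed.

Lemma is_pderivZ i r f x (dr : R) v :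
  is_derive x (delta_mx 0 i : 'rV[R]_n.+1) r dr -> is_pderiv i f x v ->
  is_pderiv i (fun y => r y *: f y) x (dr *: f x + r x *: v).
Proof.
move=> hr df A.
rewrite (_ : (fun y => _) = r * (fun y => ccoord (f y) A)); last first.
  by apply/funext => y; rewrite ccoordZ.
apply: is_derive_eq; first exact: (is_deriveM hr (df A)).
by rewrite ccoordD !ccoordZ addrC /GRing.scale /= [ccoord _ _ * _]mulrC.
Qed.

Lemma is_pderivM i f g x u v : is_pderiv i f x u -> is_pderiv i g x v ->
  is_pderiv i (fun y => f y * g y) x (u * g x + f x * v).
Proof.
move=> df dg A; rewrite (_ : (fun y => _) = (fun y => \sum_(B : {set 'I_n})
  ((-1) ^+ csign B (symd B A) \*:
    ((fun y => ccoord (f y) B) * (fun y => ccoord (g y) (symd B A)))) y)).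
  apply: is_derive_eq; first by apply: is_derive_bigsum => B; apply: is_deriveZ;
    exact: is_deriveM.
  rewrite ccoordD !ccoordM -big_split; apply: eq_bigr => B _ /=.
  by rewrite /GRing.scale /=; ring.
by apply/funext => y; rewrite ccoordM.
Qed.

Lemma is_pderiv_linear i f x : linear f -> is_pderiv i f x (f (delta_mx 0 i)).
Proof.
move=> lf A; apply: is_derive_affine => h.
by rewrite lf ccoordD ccoordZ addrC.
Qed.

(** Differentiating f f^-1 = 1 determines the derivative of the inverse once it
  exists; existence does not follow from this and is left as a hypothesis. *)
Lemma is_pderivV i f x v : (\near x, f x \is a GRing.unit) ->
  is_pderiv i f x v -> pderivable i (fun y => (f y)^-1) x ->
  is_pderiv i (fun y => (f y)^-1) x (- ((f x)^-1 * v * (f x)^-1)).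
Proof.
move=> fU df /pderivableP dV; have fxU := nbhs_singleton fU.
have /is_pderivE : is_pderiv i (fun y => f y * (f y)^-1) x 0.
  apply: is_pderiv_near (is_pderiv_cst i x 1).
  by apply: filterS fU => y yU; rewrite divrr.
rewrite (is_pderivE (is_pderivM df dV)) => /eqP.
rewrite addrC addr_eq0 => /eqP E.
by rewrite -mulrA -mulrN -E mulKr.
Qed.

(** Since [pclif] sends the basis vector of index 0 to 1, the two parts of the
  Dirac operator merge into one sum over the paravector basis. *)
Lemma DleftE f x : Dleft f x = \sum_i pclif (delta_mx 0 i) * pderiv i f x.
Proof.
rewrite big_ord_recl pclif_delta0 mul1r; congr (_ + _).
by apply: eq_bigr => j _; rewrite cgen_pclif.
Qed.

Lemma DrightE f x : Dright f x = \sum_i pderiv i f x * pclif (delta_mx 0 i).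
Proof.
rewrite big_ord_recl pclif_delta0 mulr1; congr (_ + _).
by apply: eq_bigr => j _; rewrite cgen_pclif.
Qed.

End PartialDerivatives.

(** * The Cauchy kernels and their derivatives *)

Section Kernel.
Context {R : realType} {n : nat} (s : 'rV[R]_n.+1).
Implicit Types (x y v : 'rV[R]_n.+1) (i : 'I_n.+1).

Lemma is_derive_coord x v i : is_derive x v (fun y => y 0 i) (v 0 i).
Proof. by apply: is_derive_affine => h; rewrite !mxE addrC. Qed.

Lemma is_derive_enorm2 x i :
  is_derive x (delta_mx 0 i : 'rV[R]_n.+1) (@enorm2 R n) (2 * x 0 i).
Proof.
apply: is_derive_eq.
  apply: (@is_derive_bigsum _ _ _ _
    (fun j => (fun y : 'rV[R]_n.+1 => y 0 j) ^+ 2)).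
  by move=> j; exact: is_deriveX (is_derive_coord _ _ j).
rewrite (bigD1 i) //= big1 ?addr0 => [|j ji].
  by rewrite !mxE !eqxx expr1 /GRing.scale /= mulr1.
by rewrite !mxE (negbTE ji) andbF scaler0.
Qed.

(** In this form the dependence on y is through [enorm2 y] and the scalar
  coordinate only. *)
Lemma QreE y :
  Qre s y = enorm2 y - y 0 ord0 ^+ 2 + (y 0 ord0 - s 0 ord0) ^+ 2
    - enorm2 (pvec s).
Proof. by rewrite /Qre (enorm2_pvec y); ring. Qed.

Lemma Qnorm2_continuous : continuous (Qnorm2 s).
Proof.
have coordC i : continuous (fun y : 'rV[R]_n.+1 => y 0 i).
  exact: coord_continuous.
have sqrC (f : 'rV[R]_n.+1 -> R) :
    continuous f -> continuous (fun y => f y ^+ 2).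
  by move=> fC y; exact: (cvgM (fC y) (fC y)).
have enormC : continuous (@enorm2 R n).
  apply: continuous_big => [|i _]; first exact: add_continuous.
  exact/sqrC/coordC.
have cstC (a : R) : continuous (fun _ : 'rV[R]_n.+1 => a).
  exact: cst_continuous.
have addC (f g : 'rV[R]_n.+1 -> R) : continuous f -> continuous g ->
    continuous (fun y => f y + g y).
  by move=> fC gC y; exact: (cvgD (fC y) (gC y)).
have oppC (f : 'rV[R]_n.+1 -> R) : continuous f -> continuous (fun y => - f y).
  by move=> fC y; exact: (cvgN (fC y)).
have mulC (f g : 'rV[R]_n.+1 -> R) : continuous f -> continuous g ->
    continuous (fun y => f y * g y).
  by move=> fC gC y; exact: (cvgM (fC y) (gC y)).
have QreC : continuous (Qre s).
  rewrite (funext QreE).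
  have y0C := coordC ord0; have ys0C := addC _ _ y0C (cstC (- s 0 ord0)).
  have dC := addC _ _ enormC (oppC _ (sqrC _ y0C)).
  exact: addC _ _ (addC _ _ dC (sqrC _ ys0C)) (cstC (- enorm2 (pvec s))).
have QimC : continuous (Qim s).
  exact: mulC _ _ (cstC 2) (addC _ _ (cstC (s 0 ord0)) (oppC _ (coordC ord0))).
exact: addC _ _ (sqrC _ QreC) (mulC _ _ (sqrC _ QimC) (cstC (enorm2 (pvec s)))).
Qed.

Lemma Qnorm2_near y : Qnorm2 s y != 0 -> \near y, Qnorm2 s y != 0.
Proof. exact: (cvgr_neq0 _ (@Qnorm2_continuous y)). Qed.

Lemma Qc_unit y : Qnorm2 s y != 0 -> Qc s y \is a GRing.unit.
Proof.
move=> N0; have [QQ QQ'] := QcM_conj s y.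
apply/unitrP; exists ((Qnorm2 s y)^-1 *: Qconj s y).
by rewrite -scalerAl -scalerAr QQ QQ' scalerA mulVf// scale1r.
Qed.

Lemma QcV y : Qnorm2 s y != 0 -> (Qc s y)^-1 = (Qnorm2 s y)^-1 *: Qconj s y.
Proof.
move=> N0; have QU := Qc_unit N0.
apply: (mulrI QU); rewrite divrr// -scalerAr.
by have [-> _] := QcM_conj s y; rewrite scalerA mulVf// scale1r.
Qed.

(** The i-th partial derivative of [Qc s]. *)
Definition Qder i y : clifford R n :=
  (2 * y 0 i)%:A - (2 * (i == ord0)%:R) *: pclif s.

Lemma is_pderiv_Qc i y : is_pderiv i (Qc s) y (Qder i y).
Proof.
(* the shape in which the sum and product rules produce the derivative *)
have -> : Qder i y = 0 +
    ((- (2 * (delta_mx 0 i : 'rV[R]_n.+1) 0 ord0)) *: pclif s +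
     (- (2 * y 0 ord0)) *: 0) + ((2 * y 0 i) *: 1 + enorm2 y *: 0).
  rewrite !scaler0 add0r !addr0 addrC scaleNr mxE eqxx eq_sym /=.
  by rewrite /Qder.
apply: is_pderivD; first apply: is_pderivD.
- exact: is_pderiv_cst.
- rewrite (_ : (fun z : 'rV[R]_n.+1 => - ((2 * z 0 ord0) *: pclif s)) =
      (fun z => (- (2 * z 0 ord0)) *: pclif s));
    last by apply/funext => z; rewrite scaleNr.
  apply: is_pderivZ; last exact: is_pderiv_cst.
  apply: is_deriveN; exact: is_deriveZ (is_derive_coord _ _ _).
- by apply: is_pderivZ; [exact: is_derive_enorm2|exact: is_pderiv_cst].
Qed.

Lemma is_pderiv_Qder i y : is_pderiv i (Qder i) y (2%:A).
Proof.
have -> : 2%:A =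
    ((2 * (delta_mx 0 i : 'rV[R]_n.+1) 0 i) *: 1 + (2 * y 0 i) *: 0) + 0
    :> clifford R n.
  by rewrite scaler0 !addr0 mxE !eqxx mulr1.
apply: is_pderivD; last exact: is_pderiv_cst.
apply: is_pderivZ; last exact: is_pderiv_cst.
exact: is_deriveZ (is_derive_coord _ _ _).
Qed.

Lemma derivable_Qim y v : derivable (Qim s) y v.
Proof.
apply: derivableM; first exact: derivable_cst.
apply: derivableB; first exact: derivable_cst.
by case: (is_derive_coord y v ord0).
Qed.

Lemma derivable_Qre y i : derivable (Qre s) y (delta_mx 0 i : 'rV[R]_n.+1).
Proof.
have d0 : derivable (fun z : 'rV[R]_n.+1 => z 0 ord0) y (delta_mx 0 i).
  by case: (is_derive_coord y (delta_mx 0 i) ord0).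
have dn : derivable (@enorm2 R n) y (delta_mx 0 i).
  by case: (is_derive_enorm2 y i).
have ds := derivableB d0 (derivable_cst (s 0 ord0) y (delta_mx 0 i)).
rewrite (funext QreE).
exact: (derivableB
  (derivableD (derivableB dn (derivableX (n := 2) d0)) (derivableX (n := 2) ds))
  (derivable_cst _ _ _)).
Qed.

(** The closed form of [QcV] makes every coordinate a rational function of y with
  denominator [Qnorm2 s y]. *)
Lemma pderivable_QcV i y : Qnorm2 s y != 0 ->
  pderivable i (fun z => (Qc s z)^-1) y.
Proof.
move=> N0 A; apply: (@near_eq_derivable _ _ _ (fun z => (Qnorm2 s z)^-1 *
    (Qre s z * ccoord 1 A + Qim s z * - ccoord (pclif (pvec s)) A))).
  apply: filterS (Qnorm2_near N0) => z zN0.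
  rewrite QcV// /Qconj; move: (pclif _) => v.
  by rewrite !(ccoordZ, ccoordD, ccoordN) mulrN.
have dre := @derivable_Qre y i; have dim := @derivable_Qim y (delta_mx 0 i).
have dN : derivable (Qnorm2 s) y (delta_mx 0 i : 'rV[R]_n.+1) := derivableD
  (derivableX (n := 2) dre)
  (derivableM (derivableX (n := 2) dim) (derivable_cst _ _ _)).
exact: (derivableM (derivableV N0 dN) (derivableD
  (derivableM dre (derivable_cst _ _ _))
  (derivableM dim (derivable_cst _ _ _)))).
Qed.

Lemma is_pderiv_QcV i y : Qnorm2 s y != 0 ->
  is_pderiv i (fun z => (Qc s z)^-1) y (- ((Qc s y)^-1 * Qder i y * (Qc s y)^-1)).
Proof.
move=> N0; apply: is_pderivV; last exact: pderivable_QcV.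
  by apply: filterS (Qnorm2_near N0) => z; exact: Qc_unit.
exact: is_pderiv_Qc.
Qed.

(** Q is a polynomial in s with real coefficients. *)
Lemma comm_Qc y : GRing.comm (pclif s) (Qc s y).
Proof.
apply: commrD; last exact/commr_sym/comm_alg.
apply: commrB; first exact/commrX/commr_refl.
by rewrite /GRing.comm -scalerAl -scalerAr.
Qed.

Lemma comm_Qder y i u : GRing.comm (pclif s) u -> GRing.comm (Qder i y) u.
Proof.
move=> su; apply/commr_sym/commrB; first exact/commr_sym/comm_alg.
by rewrite /GRing.comm -scalerAl -scalerAr su.
Qed.

Lemma Qder_QcV y i : Qnorm2 s y != 0 ->
  (Qc s y)^-1 * Qder i y = Qder i y * (Qc s y)^-1.
Proof. by move=> N0; apply/esym/comm_Qder/commrV/comm_Qc. Qed.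

Lemma sum_ord0 (F : 'I_n.+1 -> clifford R n) :
  \sum_i (i == ord0)%:R *: F i = F ord0.
Proof.
rewrite (bigD1 ord0) //= scale1r big1 ?addr0// => i /negbTE->.
by rewrite scale0r.
Qed.

(** With W = s - conj y the sum is 2 y W - 2 W s, because the scalar parts of the
  [Qder i y] recombine the basis into y and the summand of index 0 alone involves
  s. Expanding gives 2 ((y + conj y) s - y conj y - s^2), which is - 2 Q. *)
Lemma sum_Qder_left y :
  \sum_i pclif (delta_mx 0 i) * (pclif s - pclif (pconj y)) * Qder i y =
  - 2 *: Qc s y.
Proof.
set W := _ - _.
have E i : pclif (delta_mx 0 i) * W * Qder i y =
    2 *: (y 0 i *: pclif (delta_mx 0 i) * W) -
    (i == ord0)%:R *: (2 *: (pclif (delta_mx 0 i) * (W * pclif s))).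
  rewrite /Qder mulrBr -scalerAr mulr1 -scalerAr -!scalerAl -mulrA !scalerA.
  by rewrite [2 * _%:R]mulrC.
rewrite (eq_bigr _ (fun i _ => E i)) sumrB -scaler_sumr -mulr_suml pclif_sum.
rewrite sum_ord0 pclif_delta0 mul1r /W.
rewrite mulrBr pclifM_conj mulrBl pclif_conj mulrBl -scalerAl mul1r -expr2 /Qc.
by_coord.
Qed.

(** Mirror image of [sum_Qder_left]: the sum is 2 W y - 2 s W. *)
Lemma sum_Qder_right y :
  \sum_i Qder i y * (pclif s - pclif (pconj y)) * pclif (delta_mx 0 i) =
  - 2 *: Qc s y.
Proof.
set W := _ - _.
have E i : Qder i y * W * pclif (delta_mx 0 i) =
    2 *: (W * (y 0 i *: pclif (delta_mx 0 i))) -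
    (i == ord0)%:R *: (2 *: (pclif s * W * pclif (delta_mx 0 i))).
  clearbody W; rewrite /Qder !mulrBl -!scalerAl mul1r -scalerAr !scalerA.
  by rewrite [2 * _%:R]mulrC.
rewrite (eq_bigr _ (fun i _ => E i)) sumrB -scaler_sumr -mulr_sumr pclif_sum.
rewrite sum_ord0 pclif_delta0 mulr1 /W.
rewrite mulrBl pclif_conjM mulrBr pclif_conj mulrBr -scalerAr mulr1 -expr2 /Qc.
by_coord.
Qed.

(** The squares are 4 y_i^2, with additional terms - 8 y_0 s + 4 s^2 at index 0. *)
Lemma sum_Qder_sqr y : \sum_i Qder i y ^+ 2 = 4 *: Qc s y.
Proof.
have E i : Qder i y ^+ 2 = (4 * y 0 i ^+ 2)%:A +
    (i == ord0)%:R *: (4 *: pclif s ^+ 2 - (8 * y 0 i) *: pclif s).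
  rewrite /Qder; move: (pclif s) (y 0 i) => u a; set rhs := RHS.
  rewrite expr2 mulrBl !mulrBr -!scalerAl !mul1r -!scalerAr mulr1 -expr2 /rhs.
  by case: (i == ord0) => /=; by_coord.
rewrite (eq_bigr _ (fun i _ => E i)) big_split /= sum_ord0 -scaler_suml.
by rewrite -mulr_sumr /Qc -/(enorm2 y); by_coord.
Qed.

Lemma is_pderiv_conj i y :
  is_pderiv i (fun z => pclif s - pclif (pconj z)) y
    (- pclif (pconj (delta_mx 0 i))).
Proof.
rewrite -[X in is_pderiv _ _ _ X]add0r; apply: is_pderivD.
  exact: is_pderiv_cst.
apply: (@is_pderiv_linear _ _ i (fun z => - pclif (pconj z))) => a u v.
by rewrite !pclif_conj !mxE (linearP (@pclif R n)) /=; by_coord.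
Qed.

Lemma is_pderiv_SLinv i y : Qnorm2 s y != 0 -> is_pderiv i (SLinv s) y
  (- pclif (pconj (delta_mx 0 i)) * (Qc s y)^-1 + (pclif s - pclif (pconj y)) *
   (- ((Qc s y)^-1 * Qder i y * (Qc s y)^-1))).
Proof.
by move=> N0; apply: is_pderivM; [exact: is_pderiv_conj|exact: is_pderiv_QcV].
Qed.

Lemma is_pderiv_SRinv i y : Qnorm2 s y != 0 -> is_pderiv i (SRinv s) y
  (- ((Qc s y)^-1 * Qder i y * (Qc s y)^-1) * (pclif s - pclif (pconj y)) +
   (Qc s y)^-1 * - pclif (pconj (delta_mx 0 i))).
Proof.
by move=> N0; apply: is_pderivM; [exact: is_pderiv_QcV|exact: is_pderiv_conj].
Qed.

Lemma Dleft_SLinv y : Qnorm2 s y != 0 ->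
  Dleft (SLinv s) y = (1 - n%:R) *: (Qc s y)^-1.
Proof.
move=> N0; rewrite DleftE; set V := (Qc s y)^-1.
have E i : pclif (delta_mx 0 i) * pderiv i (SLinv s) y = - V -
    pclif (delta_mx 0 i) * (pclif s - pclif (pconj y)) * Qder i y * (V * V).
  rewrite (is_pderivE (is_pderiv_SLinv i N0)) Qder_QcV// -/V.
  rewrite mulrDr mulNr !mulrN !mulrA pclifM_conj enorm2_delta scale1r mul1r.
  by rewrite -!mulrA.
rewrite (eq_bigr _ (fun i _ => E i)) sumrB -mulr_suml sum_Qder_left sumr_const.
rewrite card_ord -scalerAl mulrA divrr ?Qc_unit// mul1r -scaler_nat.
rewrite -natr1; by_coord.
Qed.

Lemma Dright_SRinv y : Qnorm2 s y != 0 ->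
  Dright (SRinv s) y = (1 - n%:R) *: (Qc s y)^-1.
Proof.
move=> N0; rewrite DrightE; set V := (Qc s y)^-1.
have E i : pderiv i (SRinv s) y * pclif (delta_mx 0 i) = - V -
    V * V * (Qder i y * (pclif s - pclif (pconj y)) * pclif (delta_mx 0 i)).
  rewrite (is_pderivE (is_pderiv_SRinv i N0)) -mulrA -Qder_QcV// -/V.
  rewrite mulrDl !mulNr addrC mulrN mulNr -!mulrA pclif_conjM enorm2_delta.
  by rewrite scale1r mulr1.
rewrite (eq_bigr _ (fun i _ => E i)) sumrB -mulr_sumr sum_Qder_right sumr_const.
rewrite card_ord -scalerAr -mulrA mulVr ?Qc_unit// mulr1 -scaler_nat.
rewrite -natr1; by_coord.
Qed.

(** [Qder i y] commutes with the inverse of Q, and so the three factors of the first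
  derivative can be differentiated as if in a commutative ring. *)
Lemma is_pderiv2_QcV i y : Qnorm2 s y != 0 ->
  is_pderiv i (pderiv i (fun z => (Qc s z)^-1)) y
  (2 *: (Qder i y ^+ 2 * (Qc s y)^-1 ^+ 3) - 2 *: (Qc s y)^-1 ^+ 2).
Proof.
move=> N0; have dV := is_pderiv_QcV i N0.
apply: (@is_pderiv_near _ _ _
  (fun z => - 1 *: ((Qc s z)^-1 * Qder i z * (Qc s z)^-1))).
  apply: filterS (Qnorm2_near N0) => z zN0.
  by rewrite (is_pderivE (is_pderiv_QcV i zN0)) scaleN1r.
have := is_pderivZ (is_derive_cst (- 1 : R) y (delta_mx 0 i : 'rV[R]_n.+1))
  (is_pderivM (is_pderivM dV (is_pderiv_Qder i y)) dV).
congr is_pderiv; rewrite scale0r add0r /= scaleN1r.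
have := Qder_QcV i N0; move: (Qc s y)^-1 (Qder i y) => V q Vq.
rewrite mulrDl -scalerAr mulr1 -scalerAl mulrN !mulNr.
have VqA u : V * (q * u) = q * (V * u) by rewrite mulrA Vq mulrA.
have -> : V * q * V * q * V = q ^+ 2 * V ^+ 3.
  by rewrite !exprS expr0 !mulr1 -!mulrA !VqA.
have -> : V * q * (V * q * V) = q ^+ 2 * V ^+ 3.
  by rewrite !exprS expr0 !mulr1 -!mulrA !VqA.
rewrite -expr2; by_coord.
Qed.

Lemma laplacian_QcV y : Qnorm2 s y != 0 ->
  laplacian (fun z => (Qc s z)^-1) y = (6 - 2 * n%:R) *: Qc s y ^- 2.
Proof.
move=> N0; rewrite /laplacian.
rewrite (eq_bigr _ (fun i _ => is_pderivE (is_pderiv2_QcV i N0))) sumrB.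
rewrite -scaler_sumr -mulr_suml sum_Qder_sqr sumr_const card_ord.
have -> : (4 *: Qc s y) * (Qc s y)^-1 ^+ 3 = 4 *: Qc s y ^- 2.
  by rewrite -scalerAl exprS mulrA divrr ?Qc_unit// mul1r exprVn.
by rewrite exprVn -[_ *+ n.+1]scaler_nat -natr1; by_coord.
Qed.

(** Second derivatives at x only see F near x, and the points where Q is
  invertible form a neighbourhood of x. *)
Lemma laplacian_mulQcV (F : 'rV[R]_n.+1 -> clifford R n) (c : R) x :
  (forall y, Qnorm2 s y != 0 -> F y = c *: (Qc s y)^-1) ->
  Qnorm2 s x != 0 ->
  pdiff2 F x /\ laplacian F x = (c * (6 - 2 * n%:R)) *: Qc s x ^- 2.
Proof.
move=> FE x0.
have dF i y : Qnorm2 s y != 0 ->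
    is_pderiv i F y (c *: pderiv i (fun z => (Qc s z)^-1) y).
  move=> N0; apply: (@is_pderiv_near _ _ _ (fun z => c *: (Qc s z)^-1)).
    by apply: filterS (Qnorm2_near N0) => z /FE.
  have := is_pderivZ (is_derive_cst c y (delta_mx 0 i : 'rV[R]_n.+1))
    (pderivableP (pderivable_QcV (i := i) N0)).
  by rewrite scale0r add0r.
have d2F i : is_pderiv i (pderiv i F) x
    (c *: pderiv i (pderiv i (fun z => (Qc s z)^-1)) x).
  apply: (@is_pderiv_near _ _ _
    (fun z => c *: pderiv i (fun z => (Qc s z)^-1) z)).
    by apply: filterS (Qnorm2_near x0) => z /(dF i)/is_pderivE.
  have := is_pderivZ (is_derive_cst c x (delta_mx 0 i : 'rV[R]_n.+1))
    (pderivableP (is_pderiv_derivable (is_pderiv2_QcV i x0))).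
  by rewrite scale0r add0r.
split; last first.
  rewrite -scalerA -laplacian_QcV// scaler_sumr.
  by apply: eq_bigr => i _; exact: is_pderivE (d2F i).
split=> [|i]; last exact: is_pderiv_derivable (d2F i).
apply: filterS (Qnorm2_near x0) => y N0 i.
exact: is_pderiv_derivable (dF i y N0).
Qed.

End Kernel.

Theorem theorem6p12 (R : realType) (s x : 'rV[R]_6) :
  ~ psphere s x ->
  [/\ Qc s x \is a GRing.unit,
      [/\ pdiff1 (SLinv s) x, pdiff2 (Dleft (SLinv s)) x &
          SDeltaDL s x = 16%:R *: Qc s x ^- 2] &
      [/\ pdiff1 (SRinv s) x, pdiff2 (Dright (SRinv s)) x &
          SDeltaDR s x = 16%:R *: Qc s x ^- 2]].
Proof.
move=> /Qnorm2_neq0 N0.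
have -> : 16%:R = (1 - 5%:R) * (6 - 2 * 5%:R) :> R by ring.
have [dL lapL] := laplacian_mulQcV (@Dleft_SLinv R 5 s) N0.
have [dR lapR] := laplacian_mulQcV (@Dright_SRinv R 5 s) N0.
split; first exact: Qc_unit.
- split; [|exact: dL|exact: lapL].
  apply: filterS (Qnorm2_near N0) => y yN0 i.
  exact: is_pderiv_derivable (is_pderiv_SLinv i yN0).
- split; [|exact: dR|exact: lapR].
  apply: filterS (Qnorm2_near N0) => y yN0 i.
  exact: is_pderiv_derivable (is_pderiv_SRinv i yN0).
Qed.
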